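(* Let $\mathfrak{N}$ be a locally compact, compactly generated topological group, let $G\subset\mathfrak{N}$ be a closed subgroup, let $H$ be a topological group, and let $i_1,i_2\colon H\to G$ be two injective homomorphisms, each a topological isomorphism onto an open subgroup of finite index in $G$. Suppose $\phi$ is an automorphism of the topological group $\mathfrak{N}$ with $\phi(i_1(h))=i_2(h)$ for all $h\in H$. Let $\Gamma$ be the corresponding $\mathfrak{N}$-BS group (the topological HNN extension of $G$ defined by $t\,i_1(h)\,t^{-1}=i_2(h)$ for $h\in H$), let $T$ be its Bass-Serre tree, let $\widetilde{\mathfrak{N}}=\mathbb{Z}\ltimes\mathfrak{N}$ be the semidirect product given by $\phi$, and let $j_T\colon\Gamma\to \mathrm{Aut}(T)$ and $j_{\mathfrak{N}}\colon\Gamma\to\widetilde{\mathfrak{N}}$ be the canonical homomorphisms. Then the homomorphism $$j=(j_T,j_{\mathfrak{N}})\colon\Gamma\to \mathrm{Aut}(T)\times\widetilde{\mathfrak{N}}$$ is an embedding of topological groups (a homeomorphism onto its image) onto a closed subgroup.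
   Context: Topological groups are Hausdorff. $\mathfrak{N}$-BS group: as an abstract group, $\Gamma$ is the HNN extension of $G$ with stable letter $t$ and relations $t\,i_1(h)\,t^{-1}=i_2(h)$ for all $h\in H$; that is, if $G=\langle S\mid R\rangle$ then $\Gamma=\langle S,t\mid R,\ t\,i_1(h)\,t^{-1}=i_2(h)\ \forall h\in H\rangle$. The group $G$ is regarded as a subgroup of $\Gamma$. The topology on $\Gamma$ is the one with prebasis $\{\gamma U\gamma' : U\text{ open in }G,\ \gamma,\gamma'\in\Gamma\}$; with it $\Gamma$ is a topological group and $G\subset\Gamma$ is an open subgroup whose induced topology is its original one. Bass-Serre tree: $T$ is the tree with vertex set $\Gamma/G$ and edge set $\Gamma/i_1(H)$, the edge $\gamma i_1(H)$ joining the vertices $\gamma G$ and $\gamma t^{-1}G$. The group $\Gamma$ acts on $T$ by left multiplication, transitively on edges; vertex stabilizers are conjugates of $G$ and edge stabilizers are conjugates of $i_1(H)$. Since the $i_k(H)$ have finite index in $G$, $T$ is locally finite. $\mathrm{Aut}(T)$ is the group of simplicial automorphisms of $T$ with the compact-open topology, in which a basis of neighbourhoods of the identity is given by the sets $\mathcal{U}_K=\{g : gv=v\ \forall v\in K\}$ for compact $K\subset T$. The homomorphism $j_T\colon\Gamma\to \mathrm{Aut}(T)$ is the one given by the action of $\Gamma$ on $T$. $\widetilde{\mathfrak{N}}=\mathbb{Z}\ltimes\mathfrak{N}$ is the semidirect product in which the generator $s$ of $\mathbb{Z}$ acts by $s n s^{-1}=\phi(n)$ for $n\in\mathfrak{N}$,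 with the product topology ($\mathbb{Z}$ discrete). The homomorphism $j_{\mathfrak{N}}\colon\Gamma\to\widetilde{\mathfrak{N}}$ is the inclusion $G\subset\mathfrak{N}$ on $G$ and sends $t$ to $s$. *)

(* Defs.v *)
From HB Require Import structures.
From mathcomp Require Import all_boot all_order all_algebra.
From mathcomp Require Import all_classical all_reals all_analysis.
Set Implicit Arguments. Unset Strict Implicit. Unset Printing Implicit Defensive.
Import Order.TTheory GRing.Theory Num.Theory.
Import numFieldNormedType.Exports.

Local Open Scope quotient_scope.
Local Open Scope classical_set_scope.
Local Open Scope group_scope.

#[short(type="groupTopologicalType")]
HB.structure Definition GroupTopological := {G of Group G & Topological G}.

HB.mixin Record isTopGroup G of Group G & Topological G := {
  top_group_hausdorff : hausdorff_space G;
  mulg_continuous : continuous (fun xy : G * G => xy.1 * xy.2);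
  invg_continuous : continuous (fun x : G => x^-1) }.

#[short(type="topGroupType")]
HB.structure Definition TopGroup :=
  {G of isTopGroup G & Group G & Topological G}.

Definition top_embedding (X Y : topologicalType) (f : X -> Y) : Prop :=
  [/\ injective f, continuous f &
      forall U, open U -> exists2 W, open W & f @` U = W `&` range f].

Record subgroup (N : groupType) := Subgroup {
  subgroup_set :> set N;
  subgroup1 : subgroup_set 1;
  subgroupM : forall x y, subgroup_set x -> subgroup_set y -> subgroup_set (x * y);
  subgroupV : forall x, subgroup_set x -> subgroup_set x^-1 }.

Definition subgroup_type (N : groupType) (G : subgroup N) : Type :=
  set_type (subgroup_set G).

Section SubgroupGroup.
Variables (N : groupType) (G : subgroup N).

HB.instance Definition _ := SubChoice.copy (subgroup_type G) (set_type G).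

Fact subgroup_group_closed : group_closed (fun x : N => x \in (G : set N)).
Proof.
split=> [|x y]; rewrite !inE; first exact: subgroup1.
by move=> Gx Gy; apply: subgroupM => //; apply: subgroupV.
Qed.

HB.instance Definition _ :=
  SubChoice_isSubGroup.Build N _ (subgroup_type G) subgroup_group_closed.
End SubgroupGroup.

HB.instance Definition _ (N : groupTopologicalType) (G : subgroup N) :=
  Topological.copy (subgroup_type G) (set_type (subgroup_set G)).

Definition compactly_generated (N : groupTopologicalType) : Prop :=
  exists2 K : set N, compact K &
    forall S : subgroup N, K `<=` S -> subgroup_set S = setT.

(** [cosets f] is the set of left cosets of the image of [f]. *)

Section Cosets.
Variables (K Gam : groupType) (f : {multiplicative K -> Gam}).

Definition coset_rel (x y : Gam) : bool := `[< exists k, y = x * f k >].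

Let f1 : f 1 = 1.
Proof. by apply: (mulgI (f 1)); rewrite -gmulfM !mulg1. Qed.

Let fV k : f k^-1 = (f k)^-1.
Proof. by apply: (mulgI (f k)); rewrite -gmulfM !mulgV. Qed.

Fact coset_rel_refl : reflexive coset_rel.
Proof. by move=> x; apply/asboolP; exists 1; rewrite f1 mulg1. Qed.

Fact coset_rel_sym : symmetric coset_rel.
Proof.
suff h x y : coset_rel x y -> coset_rel y x by move=> x y; apply/idP/idP; exact: h.
move=> /asboolP[k ->]; apply/asboolP; exists k^-1.
by rewrite fV mulgK.
Qed.

Fact coset_rel_trans : transitive coset_rel.
Proof.
move=> y x z /asboolP[k ->] /asboolP[l ->]; apply/asboolP; exists (k * l).
by rewrite gmulfM mulgA.
Qed.

Canonical coset_equiv := EquivRel coset_rel coset_rel_refl coset_rel_sym coset_rel_trans.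

Definition cosets := {eq_quot coset_equiv}.
HB.instance Definition _ := Choice.on cosets.

Definition coset (x : Gam) : cosets := \pi x.

Lemma cosetP x y : coset x = coset y <-> exists k, y = x * f k.
Proof.
split=> [/eqmodP /asboolP //|h]; apply/eqmodP; exact/asboolP.
Qed.

Lemma repr_coset (c : cosets) : coset (repr c) = c.
Proof. exact: reprK. Qed.

Definition coset_act (g : Gam) (c : cosets) : cosets := coset (g * repr c).

Lemma coset_actE g x : coset_act g (coset x) = coset (g * x).
Proof.
have /cosetP[k xE] := repr_coset (coset x).
by apply/cosetP; exists k; rewrite -mulgA -xE.
Qed.

Lemma coset_actM g h c : coset_act (g * h) c = coset_act g (coset_act h c).
Proof. by rewrite -(repr_coset c) !coset_actE mulgA. Qed.

Lemma coset_act1 c : coset_act 1 c = c.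
Proof. by rewrite -(repr_coset c) coset_actE mul1g. Qed.
End Cosets.

Definition embeds_open_finite_index (H G : groupTopologicalType)
    (i : {multiplicative H -> G}) : Prop :=
  [/\ top_embedding i, open (range i) & finite_set [set: cosets i]].

(** HNN extension: presented with generators [inl g] for g in G,
    [inr true] = t and [inr false] = t^-1, the multiplication table of G
    serving as the presentation of G. *)

Section HNN.
Variables (G H : groupType) (i1 i2 : H -> G).

Definition hnn_word : Type := seq (G + bool).

Inductive hnn_eq : hnn_word -> hnn_word -> Prop :=
| hnn_eq_refl u : hnn_eq u u
| hnn_eq_sym u v : hnn_eq u v -> hnn_eq v u
| hnn_eq_trans u v w : hnn_eq u v -> hnn_eq v w -> hnn_eq u w
| hnn_eq_cat u u' v v' :
    hnn_eq u u' -> hnn_eq v v' -> hnn_eq (u ++ v) (u' ++ v')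
| hnn_eq_one : hnn_eq [:: inl 1] [::]
| hnn_eq_mul g g' : hnn_eq [:: inl g; inl g'] [:: inl (g * g')]
| hnn_eq_tV : hnn_eq [:: inr true; inr false] [::]
| hnn_eq_Vt : hnn_eq [:: inr false; inr true] [::]
| hnn_eq_conj h : hnn_eq [:: inr true; inl (i1 h); inr false] [:: inl (i2 h)].

HB.instance Definition _ := Choice.copy hnn_word (seq (G + bool)).

Definition hnn_rel (u v : hnn_word) : bool := `[< hnn_eq u v >].

Fact hnn_rel_refl : reflexive hnn_rel.
Proof. by move=> u; apply/asboolP; constructor. Qed.

Fact hnn_rel_sym : symmetric hnn_rel.
Proof. by move=> u v; apply/asboolP/asboolP; apply: hnn_eq_sym. Qed.

Fact hnn_rel_trans : transitive hnn_rel.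
Proof.
move=> v u w /asboolP uv /asboolP vw; apply/asboolP; exact: hnn_eq_trans vw.
Qed.

Canonical hnn_equiv := EquivRel hnn_rel hnn_rel_refl hnn_rel_sym hnn_rel_trans.

Definition hnn := {eq_quot hnn_equiv}.
HB.instance Definition _ := Choice.on hnn.

Definition hnn_pi (u : hnn_word) : hnn := \pi u.

Lemma hnn_piP u v : hnn_pi u = hnn_pi v <-> hnn_eq u v.
Proof. by split=> [/eqmodP /asboolP //|h]; apply/eqmodP; exact/asboolP. Qed.

Lemma hnn_repr x : hnn_pi (repr x) = x.
Proof. exact: reprK. Qed.

Lemma hnn_piK u : hnn_eq (repr (hnn_pi u)) u.
Proof. by apply/hnn_piP; rewrite hnn_repr. Qed.

Definition letter_inv (l : G + bool) : G + bool :=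
  match l with inl g => inl g^-1 | inr b => inr (~~ b) end.

Definition word_inv (u : hnn_word) : hnn_word := rev (map letter_inv u).

Definition hnn_mul (x y : hnn) : hnn := hnn_pi (repr x ++ repr y).
Definition hnn_one : hnn := hnn_pi [::].
Definition hnn_inv (x : hnn) : hnn := hnn_pi (word_inv (repr x)).

Lemma hnn_mulE u v : hnn_mul (hnn_pi u) (hnn_pi v) = hnn_pi (u ++ v).
Proof. by apply/hnn_piP; apply: hnn_eq_cat; apply: hnn_piK. Qed.

Fact hnn_mulA : associative hnn_mul.
Proof.
by move=> x y z; rewrite -(hnn_repr x) -(hnn_repr y) -(hnn_repr z) !hnn_mulE catA.
Qed.

Fact hnn_mul1 : left_id hnn_one hnn_mul.
Proof. by move=> x; rewrite -(hnn_repr x) hnn_mulE. Qed.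

Fact hnn_mulr1 : right_id hnn_one hnn_mul.
Proof. by move=> x; rewrite -(hnn_repr x) hnn_mulE cats0. Qed.

Lemma letter_invK : involutive letter_inv.
Proof. by case=> [g|b] /=; rewrite ?invgK ?negbK. Qed.

Lemma word_invK : involutive word_inv.
Proof.
move=> u; rewrite /word_inv map_rev revK -map_comp.
by rewrite (eq_map (g := id)) ?map_id// => l /=; rewrite letter_invK.
Qed.

Lemma hnn_eq_letterV l : hnn_eq [:: letter_inv l; l] [::].
Proof.
case: l => [g|[]] /=; [|exact: hnn_eq_Vt|exact: hnn_eq_tV].
apply: hnn_eq_trans (hnn_eq_mul _ _) _; rewrite mulVg; exact: hnn_eq_one.
Qed.

Lemma hnn_eq_wordV u : hnn_eq (word_inv u ++ u) [::].
Proof.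
elim: u => [|l u IH]; first exact: hnn_eq_refl.
rewrite /word_inv /= rev_cons cat_rcons.
apply: hnn_eq_trans IH; apply: hnn_eq_cat; first exact: hnn_eq_refl.
rewrite -[u in hnn_eq _ u]cat0s -[_ :: _]/([:: letter_inv l; l] ++ u).
by apply: hnn_eq_cat; [exact: hnn_eq_letterV|exact: hnn_eq_refl].
Qed.

Fact hnn_mulV : left_inverse hnn_one hnn_inv hnn_mul.
Proof.
move=> x; rewrite -{2}(hnn_repr x) hnn_mulE; apply/hnn_piP.
exact: hnn_eq_wordV.
Qed.

Fact hnn_mulrV : right_inverse hnn_one hnn_inv hnn_mul.
Proof.
move=> x; rewrite -{1}(hnn_repr x) hnn_mulE; apply/hnn_piP.
rewrite -{1}(word_invK (repr x)); exact: hnn_eq_wordV.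
Qed.

HB.instance Definition _ := isGroup.Build hnn
  hnn_mulA hnn_mul1 hnn_mulr1 hnn_mulV hnn_mulrV.

Definition hnn_in (g : G) : hnn := hnn_pi [:: inl g].
Definition hnn_t : hnn := hnn_pi [:: inr true].

Fact hnn_in_mul : {morph hnn_in : x y / x * y}.
Proof.
move=> x y; rewrite [RHS]hnn_mulE; apply/hnn_piP/hnn_eq_sym; exact: hnn_eq_mul.
Qed.
HB.instance Definition _ := isMultiplicative.Build G hnn hnn_in hnn_in_mul.

Lemma hnn_tV : hnn_t^-1 = hnn_pi [:: inr false].
Proof.
apply: (mulgI hnn_t); rewrite mulgV; apply/esym; rewrite [LHS]hnn_mulE.
apply/hnn_piP; exact: hnn_eq_tV.
Qed.

Lemma hnn_conj h : hnn_t * hnn_in (i1 h) * hnn_t^-1 = hnn_in (i2 h).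
Proof.
rewrite hnn_tV [X in X * _]hnn_mulE [LHS]hnn_mulE.
apply/hnn_piP; exact: hnn_eq_conj.
Qed.

(** The homomorphism given by f on G and t |-> k. Evaluating on representatives
    makes it total; it is a homomorphism when f is one and
    [hnn_lift_compat] holds. *)
Section Lift.
Variables (K : groupType) (f : G -> K) (k : K).

Definition letter_eval (l : G + bool) : K :=
  match l with inl g => f g | inr b => if b then k else k^-1 end.

Definition word_eval (u : hnn_word) : K :=
  foldr (fun l x => letter_eval l * x) 1 u.

Definition hnn_lift (x : hnn) : K := word_eval (repr x).

Hypothesis fM : {morph f : x y / x * y}.
Hypothesis hnn_lift_compat : forall h, k * f (i1 h) * k^-1 = f (i2 h).

Lemma word_eval_cat u v : word_eval (u ++ v) = word_eval u * word_eval v.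
Proof. by elim: u => [|l u IH] /=; rewrite ?mul1g// IH mulgA. Qed.

Let f1 : f 1 = 1.
Proof. by apply: (mulgI (f 1)); rewrite -fM !mulg1. Qed.

Lemma word_eval_eq u v : hnn_eq u v -> word_eval u = word_eval v.
Proof.
elim=> //=; rewrite ?mulg1 ?mulgV ?mulVg//.
- by move=> {}u {}v w _ -> _ ->.
- by move=> {}u u' {}v v' _ e _ e'; rewrite !word_eval_cat e e'.
- by move=> g g'; rewrite !mulg1 fM.
- by move=> h; rewrite !mulg1 mulgA.
Qed.

Lemma hnn_lift_pi u : hnn_lift (hnn_pi u) = word_eval u.
Proof. by apply: word_eval_eq; apply: hnn_piK. Qed.

Lemma hnn_liftM : {morph hnn_lift : x y / x * y}.
Proof.
move=> x y; rewrite -(hnn_repr x) -(hnn_repr y) [X in hnn_lift X]hnn_mulE.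
by rewrite !hnn_lift_pi word_eval_cat.
Qed.

Lemma hnn_lift_in g : hnn_lift (hnn_in g) = f g.
Proof. by rewrite hnn_lift_pi /= mulg1. Qed.

Lemma hnn_lift_t : hnn_lift hnn_t = k.
Proof. by rewrite hnn_lift_pi /= mulg1. Qed.
End Lift.
End HNN.

Arguments hnn_in {G H i1 i2}.
Arguments hnn_t {G H i1 i2}.

Definition hnn_prebasis (G : groupTopologicalType) (H : groupType)
    (i1 i2 : H -> G) : set (set (hnn i1 i2)) :=
  [set A | exists x U y, open U /\ A = [set x * hnn_in u * y | u in U]].

HB.instance Definition _ (G : groupTopologicalType) (H : groupType)
    (i1 i2 : H -> G) :=
  isSubBaseTopological.Build (hnn i1 i2)
    (I := set (hnn i1 i2)) (@hnn_prebasis G H i1 i2) id.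

Record graph := Graph {
  vertex : choiceType;
  edge : choiceType;
  src : edge -> vertex;
  tgt : edge -> vertex }.

(** Geometric realization: the vertices, together with an open interval for
    each edge. *)

Section Realization.
Local Open Scope ring_scope.
Variables (R : realType) (X : graph).

Definition realization : Type :=
  (vertex X + edge X * {s : R | 0 < s < 1})%type.

HB.instance Definition _ := Choice.on realization.

(** Characteristic map of the closed edge [e], extended to R by constants. *)
Definition segment (e : edge X) (s : R) : realization :=
  match insub s with
  | Some u => inr (e, u)
  | None => if s <= 0 then inl (src e) else inl (tgt e)
  end.

(** The quotient topology from the disjoint union of the (discrete) vertices
    and of one copy of [0, 1] per edge; R can be used in place of [0, 1] since
    [segment e] factors through the retraction of R onto [0, 1]. *)
Definition realization_open : set (set realization) :=
  [set O | forall e, open (segment e @^-1` O)].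

Fact realization_openT : realization_open setT.
Proof. by move=> e; rewrite preimage_setT; exact: openT. Qed.

Fact realization_openI : setI_closed realization_open.
Proof. by move=> A B oA oB e; rewrite preimage_setI; exact: openI. Qed.

Fact realization_open_bigU (I : Type) (f : I -> set realization) :
  (forall i, realization_open (f i)) -> realization_open (\bigcup_i f i).
Proof.
by move=> of_ e; rewrite preimage_bigcup; apply: bigcup_open => i _; exact: of_.
Qed.

HB.instance Definition _ := isOpenTopological.Build realization
  realization_openT realization_openI realization_open_bigU.

(** Maps sending vertices to vertices, and edges affinely onto edges. *)
Definition simplicial (f : realization -> realization) : Prop :=
  (forall v, exists w, f (inl v) = inl w) /\
  (forall e, exists e',
     (forall s, f (segment e s) = segment e' s) \/
     (forall s, f (segment e s) = segment e' (1 - s))).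

Definition is_simplicial_aut (f : realization -> realization) : Prop :=
  simplicial f /\ exists g, [/\ simplicial g, cancel f g & cancel g f].

Lemma simplicial_id : simplicial id.
Proof. by split=> [v|e]; [exists v|exists e; left]. Qed.

Lemma simplicial_comp f g : simplicial f -> simplicial g -> simplicial (f \o g).
Proof.
move=> [fV fE] [gV gE]; split=> [v|e].
  by have [w gw] := gV v; have [z fz] := fV w; exists z; rewrite /= gw.
have [e' ge] := gE e; have [e'' fe] := fE e'; exists e''.
case: ge => ge; case: fe => fe; [left|right|right|left] => s; rewrite /= ge fe//.
by congr segment; rewrite opprB addrC subrK.
Qed.

Lemma is_simplicial_aut_id : is_simplicial_aut id.
Proof. by split; [exact: simplicial_id|exists id; split=> //; exact: simplicial_id]. Qed.

Lemma is_simplicial_aut_comp f g :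
  is_simplicial_aut f -> is_simplicial_aut g -> is_simplicial_aut (f \o g).
Proof.
move=> [sf [f' [sf' fK f'K]]] [sg [g' [sg' gK g'K]]].
split; first exact: simplicial_comp.
exists (g' \o f'); split; first exact: simplicial_comp.
- exact: can_comp.
- exact: can_comp.
Qed.

Definition aut : Type :=
  set_type [set f : {compact-open, realization -> realization} | is_simplicial_aut f].

HB.instance Definition _ := Topological.on aut.

Definition aut_fun (a : aut) : realization -> realization := set_val a.

Lemma aut_funP a : is_simplicial_aut (aut_fun a).
Proof. exact: set_mem (valP a). Qed.

Lemma aut_ext a b : aut_fun a =1 aut_fun b -> a = b.
Proof. by move=> ab; apply/val_inj/funext. Qed.

Definition mk_aut f (sf : is_simplicial_aut f) : aut := exist _ f (mem_set sf).

Definition aut_one : aut := mk_aut is_simplicial_aut_id.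

Definition aut_mul (a b : aut) : aut :=
  mk_aut (is_simplicial_aut_comp (aut_funP a) (aut_funP b)).

Lemma aut_inv_subproof (a : aut) :
  {b : aut | cancel (aut_fun a) (aut_fun b) /\ cancel (aut_fun b) (aut_fun a)}.
Proof.
apply: cid; have [sf [g [sg fK gK]]] := aut_funP a.
have ag : is_simplicial_aut g by split=> //; exists (aut_fun a).
by exists (mk_aut ag).
Qed.

Definition aut_inv (a : aut) : aut := sval (aut_inv_subproof a).

Fact aut_mulA : associative aut_mul.
Proof. by move=> a b c; apply: aut_ext. Qed.
Fact aut_mul1 : left_id aut_one aut_mul.
Proof. by move=> a; apply: aut_ext. Qed.
Fact aut_mulr1 : right_id aut_one aut_mul.
Proof. by move=> a; apply: aut_ext. Qed.
Fact aut_mulV : left_inverse aut_one aut_inv aut_mul.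
Proof.
by move=> a; apply: aut_ext => x; rewrite /aut_inv; case: aut_inv_subproof => b [] /= + _; exact.
Qed.
Fact aut_mulrV : right_inverse aut_one aut_inv aut_mul.
Proof.
by move=> a; apply: aut_ext => x; rewrite /aut_inv; case: aut_inv_subproof => b [] /= _; exact.
Qed.

HB.instance Definition _ := isGroup.Build aut
  aut_mulA aut_mul1 aut_mulr1 aut_mulV aut_mulrV.
End Realization.

Section BassSerre.
Variables (G H : groupType) (i1 i2 : {multiplicative H -> G}).
Local Notation Gam := (hnn i1 i2).

Definition bs_vertex := cosets (hnn_in : {multiplicative G -> Gam}).
Definition bs_edge := cosets (hnn_in \o i1 : {multiplicative H -> Gam}).
HB.instance Definition _ := Choice.on bs_vertex.
HB.instance Definition _ := Choice.on bs_edge.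

Definition bs_src (e : bs_edge) : bs_vertex := coset _ (repr e).
Definition bs_tgt (e : bs_edge) : bs_vertex := coset _ (repr e * hnn_t^-1).

Lemma bs_srcE (x : Gam) : bs_src (coset _ x) = coset _ x.
Proof.
have /cosetP[h /= xE] := repr_coset (coset (hnn_in \o i1 : {multiplicative H -> Gam}) x).
by apply/cosetP; exists (i1 h).
Qed.

Lemma bs_tgtE (x : Gam) : bs_tgt (coset _ x) = coset _ (x * hnn_t^-1).
Proof.
have /cosetP[h /= xE] := repr_coset (coset (hnn_in \o i1 : {multiplicative H -> Gam}) x).
apply/cosetP; exists (i2 h).
by rewrite [in LHS]xE /= -(hnn_conj i1 i2) !mulgA mulgVK.
Qed.

Lemma bs_src_act g e : coset_act g (bs_src e) = bs_src (coset_act g e).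
Proof. by rewrite -(repr_coset e) bs_srcE !coset_actE bs_srcE. Qed.

Lemma bs_tgt_act g e : coset_act g (bs_tgt e) = bs_tgt (coset_act g e).
Proof. by rewrite -(repr_coset e) bs_tgtE !coset_actE bs_tgtE mulgA. Qed.

Definition bass_serre_tree : graph := Graph bs_src bs_tgt.

Variable R : realType.
Local Notation T := bass_serre_tree.

Definition tree_act (g : Gam) (p : realization R T) : realization R T :=
  match p with
  | inl v => inl (coset_act g (v : bs_vertex))
  | inr (e, s) => inr (coset_act g (e : bs_edge), s)
  end.

Lemma tree_act_segment g e s :
  tree_act g (segment e s) = segment (coset_act g (e : bs_edge) : edge T) s.
Proof.
rewrite /segment; case: insubP => //= _; case: ifP => _ /=; congr inl.
  exact: bs_src_act.
exact: bs_tgt_act.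
Qed.

Lemma tree_actM g h p : tree_act (g * h) p = tree_act g (tree_act h p).
Proof. by case: p => [v|[e s]] /=; rewrite coset_actM. Qed.

Lemma tree_act1 p : tree_act 1 p = p.
Proof. by case: p => [v|[e s]] /=; rewrite coset_act1. Qed.

Lemma tree_act_simplicial g : simplicial (tree_act g).
Proof.
split=> [v|e]; first by exists (coset_act g (v : bs_vertex)).
by exists (coset_act g (e : bs_edge)); left => s; exact: tree_act_segment.
Qed.

Lemma tree_act_aut g : is_simplicial_aut (tree_act g).
Proof.
split; first exact: tree_act_simplicial.
exists (tree_act g^-1); split; first exact: tree_act_simplicial.
- by move=> p; rewrite -tree_actM mulVg tree_act1.
- by move=> p; rewrite -tree_actM mulgV tree_act1.
Qed.

Definition j_tree (g : Gam) : aut R T := mk_aut (tree_act_aut g).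

Fact j_tree_mul : {morph j_tree : x y / x * y}.
Proof. by move=> x y; apply: aut_ext => p; exact: tree_actM. Qed.
HB.instance Definition _ := isMultiplicative.Build Gam (aut R T) j_tree j_tree_mul.
End BassSerre.

Record topAut (N : topGroupType) := TopAut {
  topAut_fun :> N -> N;
  topAut_inv : N -> N;
  topAut_funK : cancel topAut_fun topAut_inv;
  topAut_invK : cancel topAut_inv topAut_fun;
  topAutM : {morph topAut_fun : x y / x * y};
  topAut_continuous : continuous topAut_fun;
  topAut_inv_continuous : continuous topAut_inv }.

(** The pair (k, n) stands for the product n s^k. The argument [phi] only
    matters for the group structure. *)
Definition semidirect (N : topGroupType) (phi : topAut N) : Type :=
  (discrete_topology int * N)%type.

HB.instance Definition _ (N : topGroupType) (phi : topAut N) :=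
  Topological.copy (semidirect phi) (discrete_topology int * N)%type.

Section Semidirect.
Variables (N : topGroupType) (phi : topAut N).
Local Notation semidirect := (semidirect phi).

Definition topAut_exp (k : int) : N -> N :=
  match k with
  | Posz n => iter n phi
  | Negz n => iter n.+1 (topAut_inv phi)
  end.


Definition sd_one : semidirect := (0%R : int, 1).

Definition sd_mul (x y : semidirect) : semidirect :=
  (((x.1 : int) + (y.1 : int))%R, x.2 * topAut_exp x.1 y.2).

Definition sd_inv (x : semidirect) : semidirect :=
  ((- (x.1 : int))%R, (topAut_exp (- (x.1 : int))%R x.2)^-1).

Lemma topAut_expS k n : topAut_exp (k + 1)%R n = phi (topAut_exp k n).
Proof.
case: k => k /=; first by rewrite addn1 iterS.
by rewrite NegzE addrC subzSS add0r; case: k => [|k] /=; rewrite ?topAut_invK.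
Qed.

Lemma topAut_expB k n : topAut_exp (k - 1)%R n = topAut_inv phi (topAut_exp k n).
Proof. by rewrite -[in RHS](subrK 1%R k) topAut_expS topAut_funK. Qed.

Lemma topAut_expD k l n : topAut_exp (k + l)%R n = topAut_exp k (topAut_exp l n).
Proof.
elim/int_rect: k => [|k IH|k IH]; first by rewrite add0r.
  by rewrite -addn1 PoszD addrAC !topAut_expS IH.
by rewrite -addn1 PoszD opprD addrAC !topAut_expB IH.
Qed.

Lemma topAut_invM : {morph topAut_inv phi : x y / x * y}.
Proof.
move=> x y; apply: (can_inj (topAut_funK phi)).
by rewrite topAutM !topAut_invK.
Qed.

Lemma topAut_expM k : {morph topAut_exp k : x y / x * y}.
Proof.
elim/int_rect: k => [|k IH|k IH] x y //.
  by rewrite -addn1 PoszD !topAut_expS IH topAutM.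
by rewrite -addn1 PoszD opprD !topAut_expB IH topAut_invM.
Qed.

Lemma topAut_exp1 k : topAut_exp k 1 = 1.
Proof. by apply: (mulgI (topAut_exp k 1)); rewrite -topAut_expM !mulg1. Qed.

Fact sd_mulA : associative sd_mul.
Proof.
move=> x y z; congr pair; first exact: addrA.
by rewrite /= topAut_expM topAut_expD mulgA.
Qed.

Fact sd_mul1 : left_id sd_one sd_mul.
Proof. by case=> k n; congr pair; [exact: add0r|rewrite /= mul1g]. Qed.

Fact sd_mulr1 : right_id sd_one sd_mul.
Proof. by case=> k n; congr pair; [exact: addr0|rewrite /= topAut_exp1 mulg1]. Qed.

Fact sd_mulV : left_inverse sd_one sd_inv sd_mul.
Proof. by case=> k n; congr pair; [exact: addNr|rewrite /= mulVg]. Qed.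

Fact sd_mulrV : right_inverse sd_one sd_inv sd_mul.
Proof.
case=> k n; congr pair; first exact: addrN.
rewrite /=; apply: (mulgI n^-1); rewrite mulKg mulg1.
apply: (mulgI (topAut_exp k (topAut_exp (- k)%R n))).
by rewrite -topAut_expM mulgV topAut_exp1 -topAut_expD subrr /= mulgV.
Qed.

HB.instance Definition _ := isGroup.Build semidirect
  sd_mulA sd_mul1 sd_mulr1 sd_mulV sd_mulrV.

Definition sd_s : semidirect := (1%R : int, 1).
Definition sd_in (n : N) : semidirect := (0%R : int, n).

Fact sd_in_mul : {morph sd_in : x y / x * y}.
Proof. by []. Qed.
HB.instance Definition _ := isMultiplicative.Build N semidirect sd_in sd_in_mul.

Lemma sd_conj n : sd_s * sd_in n * sd_s^-1 = sd_in (phi n).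
Proof.
have v1 : topAut_inv phi 1 = 1 := topAut_exp1 (- 1)%R.
have f1 : phi 1 = 1 := topAut_exp1 1%R.
by congr pair; rewrite /= v1 invg1 f1 mulg1 mul1g.
Qed.
End Semidirect.

(** The canonical homomorphism to Z |x N; [hnn_liftM], [hnn_lift_in] and
    [hnn_lift_t] apply when phi (i1 h) = i2 h. *)
Definition j_semidirect (N : topGroupType) (phi : topAut N) (G : subgroup N)
    (H : groupType) (i1 i2 : H -> subgroup_type G) : hnn i1 i2 -> semidirect phi :=
  hnn_lift (fun g => sd_in phi (val g)) (sd_s phi).

(* Main.v *)
Require Import Defs.
From HB Require Import structures.
From mathcomp Require Import all_boot all_order all_algebra finmap.
From mathcomp Require Import all_classical all_reals all_analysis.
Set Implicit Arguments. Unset Strict Implicit. Unset Printing Implicit Defensive.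
Import Order.TTheory GRing.Theory Num.Theory.
Import numFieldNormedType.Exports.

(** Everything near a point x of Gamma takes place in the open coset x G, which
    carries the topology of G ([nbhs_hnn]): a neighbourhood of x is a set
    containing x u for all u in G close to 1. This rests on one fact about the
    HNN extension: conjugation by any x in Gamma is defined on a neighbourhood
    of 1 in G, with values in G, and is continuous at 1 ([hnn_conj_near]). It
    holds for elements of G, for t and its inverse (which exchange the open
    subgroups i1(H) and i2(H)), and is stable under products.

    By the same fact each point of T is fixed by all u in G close to 1
    ([tree_act_near]). Since a compact subset of T meets finitely many cells
    ([compact_finite_cells]), u close to 1 even fixes it pointwise, so j_T is
    continuous.

    Let v0 be the base vertex, with stabilizer G. The automorphisms agreeing
    with a given one at v0 form an open set ([aut_vertex_near]), and if j_T(z)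
    and j_T(x) agree at v0, then z = x u with u in G. For such z the second
    component j_N(x)^-1 j_N(z) is u itself, viewed in N; as G carries the
    topology of N, this shows that j is injective and open onto its image.

    Let (a, y) be in the closure of the image. Approximating a at v0 yields x
    with a(v0) = x v0. The elements j(z) close to (a, y) satisfy z = x u with u
    in G, so j_N(x)^-1 y is a limit of elements of G; as G is closed in N, it is
    some u in G. Put z0 = x u; then j_N(z0) = y, and a = j_T(z0): if a p and
    z0 p differed at some point p of T, then, points of T being closed
    ([closed_point]), there would be z = z0 w with z p <> z0 p and w in G
    arbitrarily close to 1; but such w fix p. *)
Local Open Scope classical_set_scope.
Local Open Scope group_scope.

(** * Geometric realizations and their automorphisms *)

Section Realization.
Local Open Scope ring_scope.
Variables (R : realType) (X : graph).
Local Notation T := (realization R X).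

Lemma segment_le0 (e : edge X) (s : R) : s <= 0 -> segment e s = inl (src e).
Proof.
by move=> s0; rewrite /segment insubF ?s0//; apply: contraTF s0 => /andP[/lt_geF->].
Qed.

Lemma segment_ge1 (e : edge X) (s : R) : 1 <= s -> segment e s = inl (tgt e).
Proof.
move=> s1; rewrite /segment insubF.
  by rewrite (lt_geF (lt_le_trans ltr01 s1)).
by apply: contraTF s1 => /andP[_ /lt_geF->].
Qed.

Lemma segment_val (e : edge X) (s : {s : R | 0 < s < 1}) :
  segment e (val s) = inr (e, s).
Proof. by rewrite /segment valK. Qed.

(** Closedness is tested on the parametrization of each edge. There the preimage
    of [Q] consists of at most one interior point and of some of the two closed
    rays that are collapsed to the endpoints. *)
Lemma realization_closed (Q : set T) :
    (forall e s s', Q (inr (e, s)) -> Q (inr (e, s')) -> s = s') ->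
  closed Q.
Proof.
move=> Q1; rewrite -openC.
suff: realization_open (~` Q) by [].
move=> e; rewrite -preimage_setC openC.
have -> : segment e @^-1` Q =
    ([set s | s <= 0] `&` [set s | Q (inl (src e))]) `|`
    ([set s | 1 <= s] `&` [set s | Q (inl (tgt e))]) `|`
    [set val s | s in [set s | Q (inr (e, s))]].
  apply/seteqP; split=> s /=.
    case: (leP s 0) => [s0|s0]; first by rewrite segment_le0//; left; left.
    case: (leP 1 s) => [s1|s1]; first by rewrite segment_ge1//; left; right.
    have s01 : 0 < s < 1 by rewrite s0.
    by rewrite -[s]/(val (exist (fun x : R => 0 < x < 1) s s01)) segment_val;
      right; exists (exist _ s s01).
  case=> [[[s0 Qs]|[s1 Qs]]|[s' Qs <-]]; first by rewrite segment_le0.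
    by rewrite segment_ge1.
  by rewrite segment_val.
have clcst (P : Prop) : closed [set _ : R | P].
  have [p|np] := pselect P.
    rewrite (_ : [set _ | _] = setT); first exact: closedT.
    by apply/seteqP; split.
  rewrite (_ : [set _ | _] = set0); first exact: closed0.
  by apply/seteqP; split.
apply: closedU; first apply: closedU; try apply: closedI => //.
have [[s Qs]|nQ] := pselect (exists s, Q (inr (e, s))).
  rewrite (_ : [set _ | _ in _] = [set x | x = val s]); first exact: closed_eq.
  apply/seteqP; split=> x /=; last by move=> ->; exists s.
  by move=> [s' Qs' <-]; rewrite (Q1 _ _ _ Qs Qs').
rewrite (_ : [set _ | _ in _] = set0); first exact: closed0.
by apply/seteqP; split=> // x [s Qs _]; apply: nQ; exists s.
Qed.

(** A cell is a vertex or an open edge; an element of Gamma fixing one point of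
    a cell fixes the whole cell. *)
Definition same_cell (p q : T) : Prop :=
  match p, q with
  | inl v, inl w => v = w
  | inr (e, _), inr (e', _) => e = e'
  | _, _ => False
  end.

Lemma same_cell_refl p : same_cell p p.
Proof. by case: p => [v|[e s]]. Qed.

Lemma same_cell_trans p q r : same_cell p q -> same_cell q r -> same_cell p r.
Proof. by case: p q r => [v|[e s]] [w|[e' s']] [z|[e'' s'']] //= -> ->. Qed.

Lemma same_cell_sym p q : same_cell p q -> same_cell q p.
Proof. by case: p q => [v|[e s]] [w|[e' s']] //= ->. Qed.

(** Choosing one point of [K] in each cell that it meets gives a set all of whose
    subsets are closed; being contained in a compact set, it is finite. *)
Lemma compact_finite_cells (K : set T) : compact K ->
  exists F : {fset T}, forall p, K p -> exists2 q, q \in F & same_cell p q.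
Proof.
move=> cK.
pose inK p := [pred q | `[< K q /\ same_cell p q >]].
(* The value of [choose] depends only on the predicate, so that [rep] is constant
   on the points of [K] in a cell. *)
pose rep p := choose (inK p) p.
have inKp p : K p -> inK p p.
  by move=> Kp; apply/asboolP; split=> //; exact: same_cell_refl.
have repP p : K p -> K (rep p) /\ same_cell p (rep p).
  by move=> /inKp /chooseP /asboolP.
have repE p q : K p -> K q -> same_cell p q -> rep p = rep q.
  move=> Kp Kq pq; rewrite /rep.
  have -> : choose (inK p) p = choose (inK q) p.
    apply: eq_choose => r; apply/asboolP/asboolP => -[Kr ?]; split=> //.
      exact: same_cell_trans (same_cell_sym pq) _.
    exact: same_cell_trans pq _.
  by apply: choose_id; [apply/asboolP; split=> //; exact: same_cell_sym|exact: inKp].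
pose P := rep @` K.
(* The open set [f p] contains no element of [P] other than [p]. *)
pose f (p : T) := ~` (P `\ p).
have of_ p : setT p -> open (f p).
  move=> _; rewrite openC; apply: realization_closed => e s s'.
  move=> [[q Kq qs] _] [[q' Kq' qs'] _].
  have [_ qc] := repP _ Kq; have [_ qc'] := repP _ Kq'.
  suff : inr (e, s) = inr (e, s') :> T by case.
  rewrite -qs -qs'; apply: repE => //.
  apply: same_cell_trans qc (same_cell_sym _); apply: same_cell_trans qc' _.
  by rewrite qs qs'.
have [[p0 Kp0]|K0] := pselect (K !=set0); last first.
  by exists fset0 => p Kp; case: K0; exists p.
(* [compact_cover] is stated for pointed spaces. *)
pose PT : ptopologicalType := HB.pack T (isPointed.Build T p0).
have := cK; rewrite (@compact_cover PT) => /(_ _ setT f of_)[|F _ KF].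
  by move=> p _; exists p => // -[_ /(_ erefl)].
exists F => p Kp; have [Kr pr] := repP _ Kp; exists (rep p) => //.
have [q /= qF fq] := KF _ Kr.
suff -> : rep p = q by [].
by apply: contrapT => rq; apply: fq; split=> //; exists p.
Qed.

Lemma closed_point (p : T) : closed [set p].
Proof. by apply: realization_closed => e s s' /= <- []. Qed.

(** The compact-open topology is defined on all self-maps of the realization, and
    automorphisms carry the induced topology; the criterion for convergence is
    transported along the inclusion. *)
Lemma aut_cvgP (F : set_system (aut R X)) (a : aut R X) :
  Filter F ->
  F --> a <-> forall K O, compact K -> open O ->
     (forall p, K p -> O (aut_fun a p)) ->
     \forall b \near F, forall p, K p -> O (aut_fun b p).
Proof.
move=> FF.
have imP f (K : set T) (O : set T) : (f @` K `<=` O) = (forall p, K p -> O (f p)).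
  by apply/propext; split=> [h p Kp|h _ [p Kp <-]]; apply: h => //; exists p.
have -> : F --> a <-> (@aut_fun R X @ F : set_system {compact-open, T -> T}) -->
    (aut_fun a : {compact-open, T -> T}).
  split=> [Fa U Ua|Fa U].
    apply: (Fa (@aut_fun R X @^-1` U)).
    exact: (@initial_continuous (aut R X) {compact-open, T -> T} (@aut_fun R X) a).
  move=> [_ /= [[V oV <-] Va VU]].
  apply: (@filterS _ F FF _ _ VU); apply: (Fa V); exact: open_nbhs_nbhs.
rewrite (@compact_open_cvgP T T).
split=> h K U cK oU; move: (h K U cK oU); rewrite imP => {}h /h {}h.
  by apply: (@filterS _ F FF _ _ _ h) => b /=; rewrite imP.
by apply: (@filterS _ F FF _ _ _ h) => b /=; rewrite imP.
Qed.

Lemma aut_eval_continuous (p : T) : continuous (fun a : aut R X => aut_fun a p).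
Proof.
move=> a B nB; have [+ _] := @aut_cvgP (nbhs a) a _.
move=> /(_ (fun _ => id)) h; move: (nB); rewrite nbhsE => -[U [oU Uap] UB].
have := h [set p] U (@compact_set1 _ p) oU.
move=> {}h; apply: (filterS _ (h _)); last by move=> _ ->.
by move=> b /(_ _ erefl) /UB.
Qed.

(** The other vertices form a closed set, and automorphisms map vertices to
    vertices, so an automorphism cannot move the image of [v] by a little. *)
Lemma aut_vertex_near (a : aut R X) v :
  \forall b \near a, aut_fun b (inl v) = aut_fun a (inl v).
Proof.
pose O : set T := ~` [set p | (exists w, p = inl w) /\ p <> aut_fun a (inl v)].
have oO : open O.
  by rewrite openC; apply: realization_closed => e s s' [[]].
have Oa : O (aut_fun a (inl v)) by move=> [].
have h : nbhs a ((fun b => aut_fun b (inl v)) @^-1` O).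
  exact: (@aut_eval_continuous (inl v) a O (open_nbhs_nbhs (conj oO Oa))).
apply: (filterS _ h) => b; rewrite /O /= => /not_andP[bV|/contrapT//].
by case: bV; have [[bV _] _] := aut_funP b; exact: bV.
Qed.
End Realization.

(** * Subgroups of topological groups *)

Section Subgroup.
Variables (N : topGroupType) (G : subgroup N).

Lemma subgroup_val_continuous : continuous (val : subgroup_type G -> N).
Proof. exact: (@initial_continuous (subgroup_type G) N val). Qed.

Lemma nbhs_subgroup (x : subgroup_type G) (A : set (subgroup_type G)) :
  nbhs x A <-> exists2 B, nbhs (val x) B & val @^-1` B `<=` A.
Proof.
split=> [|[B Bx BA]].
  move=> [_ /= [[V oV <-] Vx VA]]; exists V => //.
  by apply: open_nbhs_nbhs.
by apply: (filterS BA); exact: (@subgroup_val_continuous x B).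
Qed.

Fact subgroup_hausdorff : hausdorff_space (subgroup_type G).
Proof.
move=> x y xy; apply: val_inj; apply: (@top_group_hausdorff N) => A B nA nB.
have [z [Az Bz]] := xy _ _ (subgroup_val_continuous nA) (subgroup_val_continuous nB).
by exists (val z).
Qed.

Fact subgroup_mul_continuous :
  continuous (fun xy : subgroup_type G * subgroup_type G => xy.1 * xy.2).
Proof.
apply: (@continuous_comp_initial (subgroup_type G) _ N val) => -[x y].
apply: (@continuous_comp _ _ _
   (fun xy : subgroup_type G * subgroup_type G => (val xy.1, val xy.2))
   (fun xy : N * N => xy.1 * xy.2)); last exact: mulg_continuous.
apply: cvg_pair => /=.
  apply: (@cvg_comp _ _ _ fst val _ (nbhs x)); first exact: cvg_fst.
  exact: (@subgroup_val_continuous x).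
apply: (@cvg_comp _ _ _ snd val _ (nbhs y)); first exact: cvg_snd.
exact: (@subgroup_val_continuous y).
Qed.

Fact subgroup_inv_continuous : continuous (fun x : subgroup_type G => x^-1).
Proof.
apply: (@continuous_comp_initial (subgroup_type G) _ N val) => x.
have -> : val \o (fun x : subgroup_type G => x^-1) = (fun x => (val x)^-1).
  by apply/funext => y; exact: gmulfV.
apply: (@cvg_comp _ _ _ val (fun x : N => x^-1) _ (nbhs (val x))).
  exact: subgroup_val_continuous.
exact: invg_continuous.
Qed.

HB.instance Definition _ := isTopGroup.Build (subgroup_type G)
  subgroup_hausdorff subgroup_mul_continuous subgroup_inv_continuous.
End Subgroup.

Lemma mulgl_continuous (N : topGroupType) (a : N) : continuous (fun x => a * x).
Proof.
move=> x; apply: (@continuous_comp _ _ _ (fun x : N => (a, x))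
   (fun xy : N * N => xy.1 * xy.2)); last exact: mulg_continuous.
by apply: cvg_pair => /=; [exact: cvg_cst|exact: cvg_id].
Qed.

Lemma mulgr_continuous (N : topGroupType) (a : N) : continuous (fun x => x * a).
Proof.
move=> x; apply: (@continuous_comp _ _ _ (fun x : N => (x, a))
   (fun xy : N * N => xy.1 * xy.2)); last exact: mulg_continuous.
by apply: cvg_pair => /=; [exact: cvg_id|exact: cvg_cst].
Qed.

(** * The semidirect product *)

Section Semidirect.
Variables (N : topGroupType) (phi : topAut N).

Lemma topAut_exp_continuous k : continuous (topAut_exp phi k).
Proof.
have it (f : N -> N) n : continuous f -> continuous (iter n f).
  move=> cf; elim: n => [|n IH] x; first exact: cvg_id.
  by apply: (@continuous_comp _ _ _ (iter n f) f); [exact: IH|exact: cf].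
case: k => n; [exact: it (@topAut_continuous _ phi)|
               exact: (it _ n.+1 (@topAut_inv_continuous _ phi))].
Qed.

Lemma sd_mul_continuous (x : semidirect phi) :
  continuous (fun y : semidirect phi => x * y).
Proof.
move=> y A [[P Q] /= [nP nQ] PQA].
exists ([set y.1], [set n | Q (x.2 * topAut_exp phi x.1 n)]) => /=; last first.
  move=> [k n] /= [-> Qn]; apply: (PQA (_, _)); split=> //=.
  exact: nbhs_singleton nP.
split; first exact: (@discrete_set1 (discrete_topology int)).
apply: (@continuous_comp _ _ _ (topAut_exp phi x.1) (fun n => x.2 * n)) nQ.
  exact: topAut_exp_continuous.
exact: mulgl_continuous.
Qed.

Lemma sd_in_continuous : continuous (sd_in phi).
Proof.
move=> n A [[P Q] /= [nP nQ] PQA]; apply: (filterS _ nQ) => m Qm.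
by apply: (PQA (_, _)); split=> //; exact: nbhs_singleton nP.
Qed.

(** Left translation by [y] being a homeomorphism, the neighbourhoods of 1 in
    the normal factor yield neighbourhoods of [y]. *)
Lemma sd_near (y : semidirect phi) (B : set N) : nbhs (1 : N) B ->
  nbhs y [set z | B (y^-1 * z).2].
Proof.
move=> nB; apply: (@sd_mul_continuous y^-1 y [set m | B m.2]).
rewrite mulVg; exists (setT, B) => //=; last by move=> q [].
Qed.

Lemma sd_in_closed (G : set N) : closed G ->
  closed ([set m | (m.1 : int) = 0%R /\ G m.2] : set (semidirect phi)).
Proof.
move=> cG; apply: (@closedI (discrete_topology int * N)%type
   (fst @^-1` [set (0%R : int)]) (snd @^-1` G)).
  apply: (@closed_comp (discrete_topology int * N)%type (discrete_topology int)).
    by move=> x _; exact: cvg_fst.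
  exact: (@discrete_closed (discrete_topology int)).
apply: (@closed_comp (discrete_topology int * N)%type N) => // x _.
exact: cvg_snd.
Qed.
End Semidirect.

(** * Neighbourhoods in the HNN extension *)

Lemma gmulf_one (K L : groupType) (f : {multiplicative K -> L}) : f 1 = 1.
Proof. by apply: (mulgI (f 1)); rewrite -gmulfM !mulg1. Qed.

Section HNN.
Variables (G H : topGroupType) (i1 i2 : {multiplicative H -> G}).
Hypotheses (i1_emb : top_embedding i1) (i1_open : open (range i1)).
Hypotheses (i2_emb : top_embedding i2) (i2_open : open (range i2)).
Local Notation Gam := (hnn i1 i2).

Lemma open_embedding_nbhs1 (i : {multiplicative H -> G}) (V : set H) :
    top_embedding i -> open (range i) ->
  nbhs (1 : H) V -> nbhs (1 : G) (i @` V).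
Proof.
move=> [_ _ emb] oi; rewrite nbhsE => -[U [oU U1] UV].
have [W oW Weq] := emb U oU.
have : nbhs (1 : G) (i @` U).
  apply: open_nbhs_nbhs; split; first by rewrite Weq; exact: openI.
  by exists 1 => //; rewrite gmulf_one.
by apply: filterS => _ [x Ux <-]; exists x => //; exact: UV.
Qed.

Lemma preim_nbhs1 (i : {multiplicative H -> G}) (V : set G) :
  top_embedding i -> nbhs (1 : G) V -> nbhs (1 : H) (i @^-1` V).
Proof. by move=> [_ ci _] nV; apply: ci; rewrite gmulf_one. Qed.

(** Conjugation by the inverse of [x] maps a neighbourhood of 1 in [G] into [G],
    continuously at 1. It is phrased without inverses so as to compose along a
    product. *)
Definition conj_near (x : Gam) : Prop := forall V, nbhs (1 : G) V ->
  \forall u \near (1 : G), exists2 v, V v & hnn_in u * x = x * hnn_in v.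

(** Since the property is stable under products, it suffices to treat the
    letters. For the stable letter it holds because [i1] and [i2] are
    homeomorphisms onto open subgroups, conjugated into each other by it. *)
Lemma hnn_conj_near x : conj_near x.
Proof.
rewrite -(hnn_repr x); elim: (repr x) => [|l w IH] V nV.
  apply: (filterS _ nV) => u Vu; exists u => //.
  by rewrite -[hnn_pi _ _ _]/(1 : Gam) mul1g mulg1.
suff {IH w V nV} lc : conj_near (hnn_pi i1 i2 [:: l]).
  have -> : hnn_pi i1 i2 (l :: w) = hnn_pi i1 i2 [:: l] * hnn_pi i1 i2 w :> Gam.
    by rewrite [RHS]hnn_mulE.
  apply: (filterS _ (lc _ (IH V nV))) => u [v [v' Vv' vw] uv].
  by exists v' => //; rewrite mulgA uv -!mulgA vw.
case: l => [g|b] V nV; last first.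
  have sw (j1 j2 : {multiplicative H -> G}) (s : Gam) :
      top_embedding j1 -> top_embedding j2 -> open (range j2) ->
      (forall h, hnn_in (j2 h) * s = s * hnn_in (j1 h)) ->
      \forall u \near (1 : G), exists2 v, V v & hnn_in u * s = s * hnn_in v.
    move=> e1 e2 o2 js.
    apply: (filterS _ (open_embedding_nbhs1 e2 o2 (preim_nbhs1 e1 nV))).
    by move=> _ [h Vh <-]; exists (j1 h).
  case: b; first apply: (sw i1 i2) => // h.
    by rewrite -(hnn_conj i1 i2) mulgVK.
  rewrite -hnn_tV; apply: (sw i2 i1) => // h.
  by rewrite -(hnn_conj i1 i2) -!mulgA mulKg.
have : nbhs (1 : G) [set u | V (g^-1 * u * g)].
  have c : continuous (fun u : G => g^-1 * u * g).
    move=> u; apply: (@continuous_comp _ _ _ (fun u => g^-1 * u) (fun u => u * g)).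
      exact: mulgl_continuous.
    exact: mulgr_continuous.
  by apply: (c 1); rewrite mulg1 mulVg.
apply: filterS => u Vu; exists (g^-1 * u * g) => //.
by rewrite -[hnn_pi _ _ _]/(hnn_in g : Gam) -!gmulfM !mulgA mulgV mul1g.
Qed.

(** The translates [x U] of open sets of [G] belong to the prebasis. Conversely,
    if [x] is in [a U b], say [x = a u0 b], then for [u] in [G] close to 1 the
    element [b u] equals [v b] with [v] in [G] close to 1, whence
    [x u = a (u0 v) b] is in [a U b]. *)
Lemma nbhs_hnn (x : Gam) (A : set Gam) :
  nbhs x A <-> \forall u \near (1 : G), A (x * hnn_in u).
Proof.
split; last first.
  move=> nA; have : nbhs (1 : G) [set u | A (x * hnn_in u)] by exact: nA.
  rewrite nbhsE => -[U [oU U1] UA].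
  pose B : set Gam := [set x * hnn_in u * 1 | u in U].
  have oB : open B.
    exists [set B]; last by rewrite bigcup_set1.
    move=> _ ->; exists [fset B]%fset; last by rewrite set_fset1 bigcap_set1.
    by move=> C /fset1P ->; apply/mem_set; exists x, U, 1.
  have Bx : B x by exists 1 => //; rewrite gmulf_one !mulg1.
  apply: (filterS _ (open_nbhs_nbhs (conj oB Bx))) => _ [u Uu <-].
  by rewrite mulg1; exact: UA.
rewrite nbhsE => -[B [oB Bx] BA].
move: oB Bx BA => [D' D'sub <-] [C D'C Cx] CA.
have [F FD Ceq] := D'sub _ D'C.
suff : \forall u \near (1 : G), C (x * hnn_in u).
  by apply: filterS => u Cu; apply: CA; exists C.
rewrite -Ceq; apply: filter_bigI => P PF.
have [a [U [b [oU Peq]]]] : hnn_prebasis P by have := FD _ PF; rewrite inE.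
have : P x by move: Cx; rewrite -Ceq; exact.
rewrite Peq => -[u0 Uu0 u0x].
have Pb := hnn_conj_near b^-1.
have : nbhs (1 : G) [set v | U (u0 * v)].
  by apply: mulgl_continuous; rewrite mulg1; exact: open_nbhs_nbhs.
move=> /Pb; apply: filterS => u [v Uv uv].
exists (u0 * v) => //.
rewrite -u0x [hnn_in _]gmulfM -!mulgA; congr (_ * (_ * _)).
by rewrite -[hnn_in u](mulgVK b) uv !mulgA mulgV mul1g.
Qed.
End HNN.

(** * The action on the Bass-Serre tree *)

Section Tree.
Variables (R : realType) (G H : topGroupType) (i1 i2 : {multiplicative H -> G}).
Hypotheses (i1_emb : top_embedding i1) (i1_open : open (range i1)).
Hypotheses (i2_emb : top_embedding i2) (i2_open : open (range i2)).
Local Notation Gam := (hnn i1 i2).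
Local Notation T := (bass_serre_tree i1 i2).

(** If [u] is close to 1 then [u x = x v] with [v] in [G] close to 1, in
    particular with [v] in the open subgroup [i1(H)]; hence [u] fixes the vertex
    and the edge represented by [x]. *)
Lemma tree_act_near (p : realization R T) :
  \forall u \near (1 : G), tree_act (hnn_in u) p = p.
Proof.
have cn := hnn_conj_near i1_emb i1_open i2_emb i2_open.
case: p => [v|[e s]].
  apply: (filterS _ (cn (repr v) setT filterT)) => u [w _ uw] /=.
  rewrite -[in LHS](repr_coset v) coset_actE uw -[in RHS](repr_coset v).
  by congr inl; apply/esym/cosetP; exists w.
have i1n : nbhs (1 : G) (range i1).
  apply: open_nbhs_nbhs; split=> //; by exists 1 => //; rewrite gmulf_one.
apply: (filterS _ (cn (repr e) _ i1n)) => u [_ [h _ <-] uh] /=.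
rewrite -[in LHS](repr_coset e) coset_actE uh -[in RHS](repr_coset e).
by congr (inr (_, _)); apply/esym/cosetP; exists h.
Qed.

Lemma tree_act_same_cell (g : Gam) (p q : realization R T) :
  same_cell p q -> tree_act g q = q -> tree_act g p = p.
Proof.
by case: p q => [v|[e s]] [w|[e' s']] //= -> [->].
Qed.

Lemma j_tree_continuous : continuous (@j_tree G H i1 i2 R).
Proof.
move=> x; have FF : Filter (@j_tree G H i1 i2 R @ nbhs x) by exact: fmap_filter.
apply/aut_cvgP => K O cK oO xKO.
have [F KF] := compact_finite_cells cK.
suff : nbhs x [set z | forall p, K p -> O (tree_act z p)] by [].
apply/(nbhs_hnn i1_emb i1_open i2_emb i2_open).
have : \forall u \near (1 : G), forall q, q \in F -> tree_act (hnn_in u) q = q.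
  have h : nbhs (1 : G) (\bigcap_(q in [set` F])
      [set u | tree_act (hnn_in u) q = q]).
    by apply: filter_bigI => q _; exact: tree_act_near.
  by apply: (filterS _ h) => u uF q qF; exact: uF.
apply: filterS => u uF p Kp; have [q qF pq] := KF p Kp.
by rewrite tree_actM (tree_act_same_cell pq (uF q qF)); exact: xKO.
Qed.

Definition base_vertex : realization R T :=
  inl (coset (hnn_in : {multiplicative G -> Gam}) 1).

Lemma tree_act_base_vertex (x y : Gam) :
  tree_act x base_vertex = tree_act y base_vertex <-> exists u, y = x * hnn_in u.
Proof.
rewrite /= !coset_actE !mulg1; split=> [[] /cosetP //|h].
by apply: (congr1 (@inl _ _)); apply/cosetP.
Qed.
End Tree.

(** * The homomorphism to the semidirect product *)

Section JSemidirect.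
Variables (N : topGroupType) (G : subgroup N) (H : topGroupType).
Variables (i1 i2 : {multiplicative H -> subgroup_type G}) (phi : topAut N).
Hypothesis phi_i : forall h : H, phi (val (i1 h)) = val (i2 h).
Local Notation jN := (@j_semidirect N phi G H i1 i2).

Lemma j_semidirectM : {morph jN : x y / x * y}.
Proof.
apply: hnn_liftM => [g g'|h]; first by rewrite gmulfM -gmulfM.
by rewrite -phi_i sd_conj.
Qed.

Lemma j_semidirect_in (x : hnn i1 i2) u :
  jN (x * hnn_in u) = jN x * sd_in phi (val u).
Proof.
rewrite j_semidirectM; congr (_ * _); apply: hnn_lift_in => [g g'|h].
  by rewrite gmulfM -gmulfM.
by rewrite -phi_i sd_conj.
Qed.

Hypotheses (i1_emb : top_embedding i1) (i1_open : open (range i1)).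
Hypotheses (i2_emb : top_embedding i2) (i2_open : open (range i2)).

Lemma j_semidirect_continuous : continuous jN.
Proof.
move=> x A nA; suff : nbhs x [set z | A (jN z)] by [].
apply/(nbhs_hnn i1_emb i1_open i2_emb i2_open); apply/nbhs_subgroup.
exists [set n | A (jN x * sd_in phi n)]; last first.
  by move=> u /=; rewrite j_semidirect_in.
apply: (@cvg_comp _ _ _ (sd_in phi) (fun m => jN x * m) _
    (nbhs (1 : semidirect phi)) (nbhs (jN x))) nA.
  exact: sd_in_continuous.
by have := @sd_mul_continuous _ _ (jN x) 1; rewrite /continuous_at mulg1.
Qed.
End JSemidirect.

(** * The embedding *)

(** Openness onto the image can be checked on neighbourhoods; the required open
    set is the union of all open sets whose preimage lies in the given one. *)
Lemma nbhs_top_embedding (X Y : topologicalType) (f : X -> Y) :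
    injective f -> continuous f ->
    (forall x A, nbhs x A -> exists2 B, nbhs (f x) B & f @^-1` B `<=` A) ->
  top_embedding f.
Proof.
move=> fI fC fO; split=> // U oU.
exists (\bigcup_(B in [set B | open B /\ f @^-1` B `<=` U]) B).
  by apply: bigcup_open => B [].
apply/seteqP; split=> [_ [x Ux <-]|y [[B [oB BU] By] [x _ xy]]].
  split; last by exists x.
  have [B + BU] := fO x U (open_nbhs_nbhs (conj oU Ux)).
  rewrite nbhsE => -[C [oC Cfx] CB]; exists C => //; split=> // y /CB.
  exact: BU.
by exists x => //; apply: BU; rewrite /preimage /= xy.
Qed.

Theorem theorem1 (R : realType) (N : topGroupType) (G : subgroup N)
    (H : topGroupType) (i1 i2 : {multiplicative H -> subgroup_type G})
    (phi : topAut N)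
    (N_lc : locally_compact [set: N])
    (N_cg : compactly_generated N)
    (G_closed : closed (G : set N))
    (i1_emb : embeds_open_finite_index i1)
    (i2_emb : embeds_open_finite_index i2)
    (phi_i : forall h : H, phi (val (i1 h)) = val (i2 h)) :
  let j (g : hnn i1 i2) : aut R (bass_serre_tree i1 i2) * semidirect phi :=
    (j_tree R g, j_semidirect phi g) in
  [/\ {morph j : x y / x * y}, top_embedding j & closed (range j)].
Proof.
move=> j; have [e1 o1 _] := i1_emb; have [e2 o2 _] := i2_emb.
pose v0 := @base_vertex R _ _ i1 i2.
have jNM := j_semidirectM phi_i; have jNin := j_semidirect_in phi_i.
have tn := @tree_act_near R _ _ i1 i2 e1 o1 e2 o2.
have bv := @tree_act_base_vertex R _ _ i1 i2.
have valI (u v : subgroup_type G) : sd_in phi (val u) = sd_in phi (val v) -> u = v.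
  by move=> [] /val_inj.
have jM : {morph j : x y / x * y}.
  by move=> x y; congr pair; [exact: gmulfM|exact: jNM].
split=> //.
  apply: nbhs_top_embedding.
  (* Equality at [v0] gives [y = x u] with [u] in [G], and then [u = 1] in [N]. *)
  - move=> x y jxy; have /bv [u yE] := congr1 (fun q => aut_fun q.1 v0) jxy.
    have := congr1 snd jxy; rewrite /= yE jNin -[LHS]mulg1 => /mulgI.
    rewrite -[1 in LHS]/(sd_in phi (val (1 : subgroup_type G))) => /valI <-.
    by rewrite gmulf_one mulg1.
  - move=> x A [[P Q] /= [nP nQ] PQA].
    have nP' : nbhs x [set z | P (j_tree R z)] :=
      @j_tree_continuous R _ _ i1 i2 e1 o1 e2 o2 x P nP.
    have nQ' : nbhs x [set z | Q (j_semidirect phi z)] :=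
      j_semidirect_continuous phi_i e1 o1 e2 o2 nQ.
    by apply: (filterS _ (filterI nP' nQ')) => y [Py Qy]; exact: PQA.
  (* Being [v0]-close confines to the coset [x G], where the component in [N] is
     decisive. *)
  move=> x A /(nbhs_hnn e1 o1 e2 o2) /nbhs_subgroup [B nB BA].
  exists [set q | aut_fun q.1 v0 = aut_fun (j_tree R x) v0 /\
                  B ((j_semidirect phi x)^-1 * q.2).2].
    exists ([set a | aut_fun a v0 = aut_fun (j_tree R x) v0],
            [set y | B ((j_semidirect phi x)^-1 * y).2]) => //.
    by split; [exact: aut_vertex_near|exact: sd_near].
  move=> y [/esym/bv [u yE] By]; rewrite yE; apply: BA; move: By.
  by rewrite -[(j y).2]/(j_semidirect phi y) yE jNin mulKg.
move=> [a y] cl.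
have {}cl P Q : nbhs a P -> nbhs y Q ->
    exists z, P (j_tree R z) /\ Q (j_semidirect phi z).
  move=> nP nQ; have nPQ : nbhs (a, y) (P `*` Q) by exists (P, Q).
  by have [_ [[z _ <-] [Pz Qz]]] := cl _ nPQ; exists z.
have nv0 : nbhs a [set b | aut_fun b v0 = aut_fun a v0].
  exact: aut_vertex_near.
have [x [/= xv _]] := cl _ setT nv0 (@filterT _ (nbhs y) _).
(* The remaining factor [m] of [y] lies in [0 * G], since otherwise the elements
   of [j (x G)] would stay away from [(a, y)]. *)
pose m := (j_semidirect phi x)^-1 * y.
have [m0 Gm] : (m.1 : int) = 0%R /\ (G : set N) m.2.
  pose S : set (semidirect phi) := [set m | (m.1 : int) = 0%R /\ (G : set N) m.2].
  apply: (@contrapT (S m)) => nm.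
  have oS : open (~` S) by apply: closed_openC; exact: sd_in_closed.
  have nS : nbhs y [set q | ~ S ((j_semidirect phi x)^-1 * q)].
    exact: (@sd_mul_continuous _ _ _ y _ (open_nbhs_nbhs (conj oS nm))).
  have [z [/= zv zS]] := cl _ _ nv0 nS.
  have /bv [u zE] : tree_act x v0 = tree_act z v0 by exact: etrans xv (esym zv).
  apply: zS; rewrite /preimage zE jNin mulKg; split=> //; exact: set_mem (valP u).
pose u : subgroup_type G := exist _ m.2 (mem_set Gm).
have yE : j_semidirect phi (x * hnn_in u) = y.
  rewrite jNin -[RHS](mulVKg (j_semidirect phi x)); congr (_ * _).
  by rewrite -/m [RHS]surjective_pairing m0.
have av : aut_fun a v0 = tree_act (x * hnn_in u) v0.
  by apply: etrans (esym xv) _; apply/bv; exists u.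
exists (x * hnn_in u) => //; congr pair => //; apply/esym/aut_ext => p /=.
(* If [a] moves [p] elsewhere than [x u], so does some [z = x u w] in the image,
   with [w] so close to 1 that it fixes [p]. *)
apply: contrapT => ap; have /nbhs_subgroup [B nB Bp] := tn p.
have oC : open (~` [set tree_act (x * hnn_in u) p]).
  by rewrite openC; exact: closed_point.
have np : nbhs a [set b | aut_fun b p <> tree_act (x * hnn_in u) p].
  exact: (@aut_eval_continuous _ _ p a _ (open_nbhs_nbhs (conj oC ap))).
have [z [[zv zp] zB]] := cl _ _ (filterI nv0 np) (sd_near y nB).
have /bv [w zE] : tree_act (x * hnn_in u) v0 = tree_act z v0.
  exact: etrans (esym av) (esym zv).
have wp : tree_act (hnn_in w) p = p.
  apply: Bp; have : B (y^-1 * j_semidirect phi z).2 := zB.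
  by rewrite zE jNin yE mulKg.
apply: zp; rewrite zE -[LHS]/(tree_act (x * hnn_in u * hnn_in w) p).
by rewrite [LHS]tree_actM wp.
Qed.
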